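(* Let $p\ge1$, $r_1\le\cdots\le r_p$ nonnegative integers, $\mathbf{r}_p=(r_1,\ldots,r_p)$, and $\mathbf{e}_p=(0,\ldots,0,1)\in\mathbb{R}^p$. For all integers $n,m\ge0$, $$B_{n+m}(z;\mathbf{r}_p)=\sum_{j=0}^{n}{n+r_p\brace j+r_p}_{r_p}z^jB_m(z;\mathbf{r}_p+j\mathbf{e}_p),$$ $$B_{n+m}(z;\mathbf{r}_p)=\sum_{i=0}^{|\mathbf{r}_{p-1}|}\sum_{j=0}^{n}{n+r_p\brace j+r_p}_{r_p}a_i(\mathbf{r}_{p-1})z^jB_{m+i}(z;r_p+j),$$ $$z^nB_m(z;\mathbf{r}_p+n\mathbf{e}_p)=\sum_{j=0}^{n}\genfrac{[}{]}{0pt}{}{n+r_p}{j+r_p}_{r_p}(-1)^{n-j}B_{m+j}(z;\mathbf{r}_p).$$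
   Context: For a vector $\mathbf{s}=(s_1,\ldots,s_m)$ of nonnegative integers, $|\mathbf{s}|=s_1+\cdots+s_m$; let $S_1=\{1,\ldots,s_1\}$, $S_2=\{s_1+1,\ldots,s_1+s_2\}$, etc. ${N\brace k}_{\mathbf{s}}$ is the number of partitions of $\{1,\ldots,N\}$ into $k$ nonempty blocks such that for each $i$ the elements of $S_i$ lie in distinct blocks, and $B_n(z;\mathbf{s})=\sum_{k=0}^{n+s_1+\cdots+s_{m-1}}{n+|\mathbf{s}|\brace k+s_m}_{\mathbf{s}}z^k$; for a single integer $r$, ${N\brace k}_r$ is Broder's $r$-Stirling number of the second kind and $B_n(z;r)=\sum_{k=0}^n{n+r\brace k+r}_rz^k$ the $r$-Bell polynomial. $\genfrac{[}{]}{0pt}{}{N}{k}_{r}$ is Broder's $r$-Stirling number of the first kind: the number of permutations of $\{1,\ldots,N\}$ with $k$ cycles such that $1,\ldots,r$ lie in distinct cycles. With $\genfrac{[}{]}{0pt}{}{n}{k}$ unsigned Stirling numbers of the first kind, $a_i(\mathbf{r}_{p-1})=(-1)^{|\mathbf{r}_{p-1}|-i}\sum_{j_1+\cdots+j_{p-1}=i}\genfrac{[}{]}{0pt}{}{r_1}{j_1}\cdots\genfrac{[}{]}{0pt}{}{r_{p-1}}{j_{p-1}}$, where $|\mathbf{r}_{p-1}|=r_1+\cdots+r_{p-1}$. *)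

(* Defs.v *)
From mathcomp Require Import all_boot all_order all_algebra all_fingroup.

Set Implicit Arguments.
Unset Strict Implicit.
Unset Printing Implicit Defensive.

Import GRing.Theory.

Local Open Scope nat_scope.

(* The set {1, ..., N} is rendered as 'I_N = {0, ..., N - 1}, so that all     *)
(* elements are shifted by one: {1, ..., r} becomes [set x : 'I_N | x < r].   *)

Definition set_partitions (N k : nat) : {set {set {set 'I_N}}} :=
  [set P : {set {set 'I_N}} | partition P [set: 'I_N] & #|P| == k].

(* The segment S_(i+1) of {1, ..., N} attached to the vector s. *)
Definition segment (N : nat) (s : seq nat) (i : nat) : {set 'I_N} :=
  [set x : 'I_N | sumn (take i s) <= x < sumn (take i.+1 s)].

(* {N brace k}_s; dinjectiveb says that distinct elements of the segment lie  *)
(* in distinct blocks.                                                        *)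
Definition vstirling2 (s : seq nat) (N k : nat) : nat :=
  #|[set P in set_partitions N k |
      [forall i : 'I_(size s), dinjectiveb (pblock P) (segment N s i)]]|.

Definition rstirling2 (r N k : nat) : nat :=
  #|[set P in set_partitions N k |
      dinjectiveb (pblock P) [set x : 'I_N | x < r]]|.

(* porbits counts fixed points as cycles. *)
Definition stirling1 (n k : nat) : nat :=
  #|[set s : {perm 'I_n} | #|porbits s| == k]|.

Definition rstirling1 (r N k : nat) : nat :=
  #|[set s : {perm 'I_N} | (#|porbits s| == k)
      && dinjectiveb (porbit s) [set x : 'I_N | x < r]]|.

(* The last entry s_p and the vector (s_1, ..., s_(p-1)), for p >= 1. *)
Definition vlast (s : seq nat) : nat := last 0 s.
Definition vinit (s : seq nat) : seq nat := take (size s).-1 s.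

Definition e_last (p : nat) : p.-tuple nat :=
  [tuple (i.+1 == p : nat) | i < p].

(* s + j t *)
Definition add_scaled (p : nat) (s : p.-tuple nat) (j : nat)
    (t : p.-tuple nat) : p.-tuple nat :=
  [tuple tnth s i + j * tnth t i | i < p].

Local Open Scope ring_scope.

(* The variable z of the polynomials is the indeterminate 'X of {poly int}. *)
Definition vbell (n : nat) (s : seq nat) : {poly int} :=
  \sum_(0 <= k < (n + sumn (vinit s)).+1)
    (vstirling2 s (n + sumn s) (k + vlast s))%:R * 'X^k.

Definition rbell (n r : nat) : {poly int} :=
  \sum_(0 <= k < n.+1) (rstirling2 r (n + r) (k + r))%:R * 'X^k.

(* a_i(s); each j_l in a solution of j_1 + ... + j_q = i is at most i, whence *)
(* the range 'I_i.+1. The exponent is a truncated subtraction, harmless as    *)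
(* the sum vanishes for i > |s|.                                              *)
Definition acoef (s : seq nat) (i : nat) : int :=
  (-1) ^+ (sumn s - i) *
  \sum_(j : {ffun 'I_(size s) -> 'I_i.+1} | (\sum_(l < size s) j l)%N == i)
    \prod_(l < size s) (stirling1 (nth 0%N s l) (j l))%:R.

(* Main.v *)
(* The polynomial B_n(z; s) is pinned down by the values at all x : nat of the
   linear functional umbral x sending z^k to the falling factorial x^_k.
   Counting the colourings of {1, ..., n + |s|} by x + s_p colours that are
   injective on each S_i, according to the partition into colour classes,
   shows that umbral x maps B_n(z; s) to
     (x + s_p)^n * (x + s_p)^_s_1 * ... * (x + s_p)^_s_(p-1),
   while umbral x (z^j q) = x^_j * umbral (x - j) q. All three identities thus
   reduce to the expansion of (x + r_p)^n in the x^_j (second kind) and of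
   x^_n in the powers (x + r_p)^j (first kind), with r = 0 for the a_i. *)

Require Import Defs.
From mathcomp Require Import all_boot all_order all_algebra all_fingroup.

Set Implicit Arguments.
Unset Strict Implicit.
Unset Printing Implicit Defensive.

Import GRing.Theory.

Local Open Scope ring_scope.

(** * Stirling numbers of the first kind *)

Section InsertInCycle.
Local Open Scope group_scope.
Variables (T : finType) (s : {perm T}) (a b : T).
Hypothesis fix_a : s a = a.

(* tperm a b * s inserts the fixed point a of s into the cycle of b. *)
Lemma porbit_tpermM x y : x != a -> y != a ->
  (y \in porbit (tperm a b * s) x) = (y \in porbit s x).
Proof.
set t := tperm a b * s => xa ya.
(* [s] is [t] with [a] skipped: [t] sends [b] to [a] and [a] to [s b], so at [b] two steps of [t]
   make one step of [s]. *)
have sE z : z != a -> s z = if z == b then t (t z) else t z.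
  move=> za; case: eqP => [->|/eqP zb].
    by rewrite [t b]permM tpermR fix_a permM tpermL.
  by rewrite permM tpermD // eq_sym.
have s_a z : (s z == a) = (z == a) by rewrite -{1}fix_a (inj_eq perm_inj).
have porbit_step (u : {perm T}) z : u z \in porbit u z.
  by apply/porbitP; exists 1%N; rewrite expg1.
apply/idP/idP; last first.
  case/porbitP=> i; elim: i y ya => [|i IHi] y ya defy.
    by rewrite defy expg0 perm1 porbit_id.
  move: defy; rewrite expgSr permM; set z := (s ^+ i) x => defy.
  have za : z != a by rewrite -s_a -defy.
  have /eqP <- : porbit t z == porbit t x by rewrite eq_porbit_mem IHi.
  rewrite defy sE //; case: ifP => _; last exact: porbit_step.
  by apply/porbitP; exists 2; rewrite expg2 [RHS]permM.
(* Strong induction: when the predecessor of [y] is [a], one has to go back two steps, to [b]. *)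
case/porbitP=> i; elim/ltn_ind: i y ya => -[|i] IHi y ya defy.
  by rewrite defy expg0 perm1 porbit_id.
move: defy; rewrite expgSr permM; set z := (t ^+ i) x => defy.
have [za|za] := eqVneq z a; last first.
  have zx : z \in porbit s x by apply: (IHi i).
  have /eqP <- : porbit s z == porbit s x by rewrite eq_porbit_mem.
  have zb : z != b.
    by apply: contraNneq ya => zb; rewrite defy zb permM tpermR fix_a.
  by have := sE z za; rewrite (negPf zb) -defy => <-; apply: porbit_step.
move: defy; rewrite za => defy; move: za; rewrite /z {z}.
case: i IHi => [|i] IHi.
  by rewrite expg0 perm1 => xa'; rewrite xa' eqxx in xa.
rewrite expgSr permM; set w := (t ^+ i) x => twa.
have wb : w = b.
  by apply: (@perm_inj _ t); rewrite twa permM tpermR fix_a.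
have [ba|ba] := eqVneq b a.
  by move: ya; rewrite defy permM ba tperm1 perm1 fix_a eqxx.
have bx : w \in porbit s x by apply: (IHi i) => //; rewrite wb.
have /eqP <- : porbit s w == porbit s x by rewrite eq_porbit_mem.
have <- : s w = y by rewrite sE wb // eqxx -wb twa defy.
exact: porbit_step.
Qed.

(** The fixed point [a] is a cycle of its own, so for [b != a] the transposition merges two distinct
    cycles. *)
Lemma card_porbits_tpermM :
  (#|porbits (tperm a b * s)| + (b != a) = #|porbits s|)%N.
Proof.
have := porbits_mul_tperm s a b; rewrite /=.
have [-> |ab] := eqVneq b a; first by rewrite porbit_id !addn0.
have -> : a \notin porbit s b.
  rewrite porbit_sym; apply/porbitP => -[i /eqP]; apply/negP.
  suff -> : (s ^+ i) a = a by [].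
  by elim: i => [|i IHi]; rewrite ?expg0 ?perm1 // expgSr permM IHi.
by rewrite addn1 /= => /eqP; rewrite addn2 addn1 eqSS => /eqP.
Qed.

End InsertInCycle.

Section CyclePolynomial.
Variables (T : finType) (R : {set T}).

(** Permutations of [A] are kept as permutations of [T], so every point outside [A] still counts as
    a cycle. *)
Definition separating_perms (A : {set T}) : {set {perm T}} :=
  [set s | perm_on A s & dinjectiveb (porbit s) R].

(** Both [x] and [s x] lie in [R] and on the same cycle, so separation forces [s x = x]. *)
Lemma separating_perms_base : separating_perms R = [set 1%g].
Proof.
apply/setP=> s; rewrite !inE; apply/andP/eqP => [[sR /dinjectiveP s_inj]|->].
  apply/permP=> x; rewrite perm1; have [xR|] := boolP (x \in R);
    last exact: out_perm sR.
  apply: s_inj => //; first by rewrite (perm_closed _ sR).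
  by have := porbit_perm s 1 x; rewrite expg1.
split; first exact: perm_on1.
apply/dinjectiveP=> x y _ _ /eqP; rewrite eq_porbit_mem => /porbitP[i ->].
by rewrite expg1n perm1.
Qed.

(** Each permutation of [a |: A] is [tperm a b * s] for a unique [s] on [A] and [b] in [a |: A]. The
    choice [b = a] keeps the number of cycles; each of the [#|A|] others lowers it by one, which the
    factor ['X] on the left makes up for. *)
Lemma separating_perms_add (A : {set T}) (a : T) : R \subset A -> a \notin A ->
  \sum_(s in separating_perms (a |: A)) 'X^#|porbits s| * 'X =
  \sum_(s in separating_perms A) 'X^#|porbits s| * ('X + #|A|%:R) :> {poly int}.
Proof.
move=> RA aA.
have fix_a s : perm_on A s -> s a = a by move/out_perm; apply.
have dinjE s b : perm_on A s ->
    dinjectiveb (porbit (tperm a b * s)%g) R = dinjectiveb (porbit s) R.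
  move=> sA.
  have neq_a x : x \in R -> x != a.
    by move=> xR; apply: contraNneq aA => <-; apply: (subsetP RA).
  have porbE x y : x \in R -> y \in R ->
      (porbit (tperm a b * s)%g x == porbit (tperm a b * s)%g y)
        = (porbit s x == porbit s y).
    by move=> /neq_a xa /neq_a ya; rewrite !eq_porbit_mem porbit_tpermM ?fix_a.
  by apply/dinjectiveP/dinjectiveP => s_inj x y xR yR /eqP;
    [rewrite -(porbE x y) //|rewrite (porbE x y) //]; move/eqP; apply: s_inj.
pose h (u : {perm T} * T) := (tperm a u.2 * u.1)%g.
have -> : separating_perms (a |: A) =
    h @: setX (separating_perms A) (a |: A).
  apply/setP=> s; apply/idP/imsetP => [|[[s' b]]].
    rewrite inE => /andP[sA s_inj].
    (* The predecessor of [a] on its cycle; multiplying by [tperm a b] then makes [a] a fixed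
       point. *)
    set b := (s^-1)%g a; have sb : s b = a by rewrite permKV.
    have bA : b \in a |: A by rewrite -(perm_closed _ sA) sb setU11.
    have tsaA : perm_on (a |: A) (tperm a b * s)%g.
      apply: perm_onM => //; apply: subset_trans (tperm_on a b) _.
      by rewrite subUset !sub1set setU11.
    have tsA : perm_on A (tperm a b * s)%g.
      apply/subsetP=> x; rewrite inE => tsx.
      have := subsetP tsaA x; rewrite !inE tsx => /(_ isT)/predU1P[xa|//].
      by move: tsx; rewrite xa permM tpermL sb eqxx.
    have defs : s = h ((tperm a b * s)%g, b).
      by rewrite /h /= mulgA tperm2 mul1g.
    exists ((tperm a b * s)%g, b) => //; rewrite in_setX bA inE tsA /=.
    by rewrite -(dinjE _ b) // mulgA tperm2 mul1g s_inj.
  rewrite in_setX inE /= => /andP[/andP[sA s_inj] bA] ->.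
  rewrite inE dinjE // s_inj andbT perm_onM //.
    by apply: subset_trans (tperm_on a b) _; rewrite subUset !sub1set setU11.
  by apply: subset_trans sA (subsetUr _ _).
rewrite big_imset /=; last first.
  move=> [s b] [s' b']; rewrite !in_setX !inE /=.
  move=> /andP[/andP[sA _] _] /andP[/andP[s'A _] _] eqh.
  (* [b] is recovered as the preimage of [a], and then [s] by cancellation. *)
  have hb u c : perm_on A u -> h (u, c) c = a.
    by move=> uA; rewrite permM tpermR fix_a.
  have eqb : b = b' by apply: (@perm_inj _ (h (s, b))); rewrite hb // eqh hb.
  by move: eqh; rewrite /h /= eqb => /mulgI ->.
transitivity (\sum_(s in separating_perms A) \sum_(b in a |: A)
    'X^#|porbits (tperm a b * s)%g| * 'X : {poly int}).
  by rewrite pair_big; apply: eq_bigl => -[s b]; rewrite in_setX.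
apply: eq_bigr => s; rewrite inE => /andP[sA _].
rewrite big_setU1 //= tperm1 mul1g mulrDr; congr (_ + _).
rewrite mulr_natr -sumr_const; apply: eq_bigr => b bA.
have ba : b != a by apply: contraNneq aA => <-.
by rewrite -exprSr -(card_porbits_tpermM b (fix_a s sA)) ba addn1.
Qed.

End CyclePolynomial.

(** * Rising factorials as generating polynomials of cycle counts *)

Definition rising_poly (r n : nat) : {poly int} :=
  \prod_(i < n) ('X + (r + i)%:R).

Lemma card_ltn_ord (N k : nat) : (k <= N)%N ->
  #|[set x : 'I_N | (x < k)%N]| = k.
Proof.
move=> lekN; rewrite cardsE -sum1_card -(big_ord_widen N (fun=> 1%N) lekN).
by rewrite sum1_card card_ord.
Qed.

Lemma card_porbits1 (T : finType) : #|porbits (1 : {perm T})%g| = #|T|.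
Proof.
rewrite card_imset ?cardsT // => x y /eqP.
by rewrite eq_porbit_mem => /porbitP[i ->]; rewrite expg1n perm1.
Qed.

(** The points [r], ..., [r + n - 1] are adjoined one at a time to the [r] separated ones; adjoining
    [r + i] contributes the factor ['X + (r + i)]. *)
Lemma sum_separating_perms (r n : nat) :
  \sum_(s in separating_perms [set x : 'I_(n + r) | (x < r)%N] setT)
    'X^#|porbits s| = 'X^r * rising_poly r n.
Proof.
set R := [set x : 'I_(n + r) | (x < r)%N].
pose A i := [set x : 'I_(n + r) | (x < r + i)%N].
(* The [n - i] points outside [A i] are cycles, so the sum carries ['X^(n + r - i)]; the factor
   ['X^i] avoids the subtraction. *)
have step i : (i <= n)%N ->
    (\sum_(s in separating_perms R (A i)) 'X^#|porbits s|) * 'X^i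
      = 'X^(n + r) * rising_poly r i.
  elim: i => [_|i IHi lti].
    have -> : A 0%N = R by apply/setP=> x; rewrite !inE addn0.
    rewrite separating_perms_base big_set1 card_porbits1 card_ord expr0 mulr1.
    by rewrite /rising_poly big_ord0 mulr1.
  have ltN : (r + i < n + r)%N by rewrite addnC ltn_add2r.
  pose a := Ordinal ltN.
  have -> : A i.+1 = a |: A i.
    by apply/setP=> x; rewrite !inE addnS ltnS leq_eqVlt.
  rewrite exprS mulrA mulr_suml separating_perms_add; first last.
  - by rewrite inE ltnn.
  - by apply/subsetP=> x; rewrite !inE => /leq_trans; apply; apply: leq_addr.
  rewrite -mulr_suml -mulrA [_ * 'X^i]mulrC mulrA IHi ?(ltnW lti) //.
  rewrite card_ltn_ord ?(ltnW ltN) //.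
  by rewrite /rising_poly big_ord_recr /= mulrA.
have defT : A n = setT by apply/setP=> x; rewrite !inE [(r + n)%N]addnC ltn_ord.
have := step n (leqnn n); rewrite defT exprD mulrC -mulrA.
by move/(mulfI _); apply; rewrite -size_poly_eq0 size_polyXn.
Qed.

Lemma rstirling1_coef (r n j : nat) :
  (rstirling1 r (n + r) (j + r))%:R = (rising_poly r n)`_j.
Proof.
have <- : ('X^r * rising_poly r n)`_(j + r) = (rising_poly r n)`_j.
  by rewrite coefXnM ltnNge leq_addl /= addnK.
rewrite -sum_separating_perms coef_sum /rstirling1 -sum1_card natr_sum.
rewrite [RHS](eq_bigr (fun s => if #|porbits s| == (j + r)%N then 1 else 0));
  last by move=> s _; rewrite coefXn eq_sym; case: eqP.
rewrite -big_mkcondr; apply: eq_bigl => s.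
rewrite !inE; have -> : perm_on setT s by apply/subsetP=> x; rewrite inE.
by rewrite andbC.
Qed.

Lemma stirling1_coef (n j : nat) : (stirling1 n j)%:R = (rising_poly 0 n)`_j.
Proof.
rewrite -rstirling1_coef !addn0; congr _%:R; apply: eq_card => s.
rewrite !inE; case: eqP => //= _; apply/esym/dinjectiveP=> x y.
by rewrite inE.
Qed.

Lemma size_rising_poly (r n : nat) : (size (rising_poly r n) <= n.+1)%N.
Proof.
rewrite /rising_poly; elim: n => [|n IHn]; first by rewrite big_ord0 size_poly1.
rewrite big_ord_recr /= -polyC_natr; apply: leq_trans (size_polyMleq _ _) _.
by rewrite size_XaddC addn2.
Qed.

(** At [- (x + r)] the factor of index [i] becomes [- (x - i)], in which [r] has cancelled. *)
Lemma rising_poly_horner (r n x : nat) :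
  (-1) ^+ n * (rising_poly r n).[- (x + r)%:R] = (x ^_ n)%:R.
Proof.
rewrite /rising_poly; elim: n => [|n IHn].
  by rewrite big_ord0 hornerC mulr1 ffactn0.
rewrite big_ord_recr /= hornerM exprS -polyC_natr hornerD hornerX hornerC.
have -> : - (x + r)%:R + (r + n)%:R = - (x%:R - n%:R) :> int.
  by rewrite !natrD !opprD opprK -addrA addKr.
rewrite mulN1r mulNr mulrA IHn -mulrN opprK.
(* The natural difference [x - n] is the integer one unless [x < n], and then [x ^_ n] is already
   zero. *)
rewrite ffactnSr natrM; have [lenx|ltxn] := leqP n x; first by rewrite natrB.
by rewrite ffact_small // !mul0r.
Qed.

(** Since [(-1) ^+ (d - i)] is [(-1) ^+ d * (-1) ^+ i], the alternating signs pass into the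
    argument. Both signed sums of first-kind numbers become evaluations this way. *)
Lemma sum_signed_coef (p : {poly int}) (d : nat) (y : int) :
  (size p <= d.+1)%N ->
  \sum_(0 <= i < d.+1) (-1) ^+ (d - i) * p`_i * y ^+ i = (-1) ^+ d * p.[- y].
Proof.
move=> sp; rewrite (horner_coef_wide _ sp) big_mkord mulr_sumr.
apply: eq_bigr => -[i /=]; rewrite ltnS => lei _.
have -> : (-1) ^+ (d - i) = (-1) ^+ d * (-1) ^+ i :> int.
  by rewrite -[in RHS](subnK lei) exprD -mulrA -expr2 sqrr_sign mulr1.
by rewrite (exprNn y) -!mulrA [_ * (p`_i * _)]mulrCA.
Qed.

(** Truncating every factor after degree [i] preserves the coefficient of degree [i]; the product of
    the finite sums [Q l] can then be distributed. *)
Lemma coef_prod_ffun (q : nat) (P : 'I_q -> {poly int}) (i : nat) :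
  (\prod_l P l)`_i =
  \sum_(f : {ffun 'I_q -> 'I_i.+1} | (\sum_l f l)%N == i) \prod_l (P l)`_(f l).
Proof.
pose Q l := \sum_(j < i.+1) (P l)`_j *: 'X^j.
have -> : (\prod_l P l)`_i = (\prod_l Q l)`_i.
  (* Congruence modulo ['X^(i.+1)], which is compatible with products. *)
  pose eqQ (p q : {poly int}) := forall k, (k <= i)%N -> p`_k = q`_k.
  apply: (big_ind2 eqQ) => // [p p' q0 q' eqp eqq k lek|l _ k lek].
    rewrite !coefM; apply: eq_bigr => -[j /= lej] _.
    by rewrite eqp ?eqq // (leq_trans _ lek) // leq_subr.
  by rewrite /Q -poly_def coef_poly ltnS lek.
rewrite bigA_distr_bigA coef_sum [RHS]big_mkcond; apply: eq_bigr => f _.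
rewrite scaler_prod prodrXr coefZ coefXn eq_sym.
by case: eqP; rewrite ?mulr1 ?mulr0.
Qed.

(** Up to sign, [acoef s i] is a coefficient of a product of rising factorials, and evaluation at
    [- y] turns each of these into a falling factorial. *)
Lemma sum_acoef (s : seq nat) (y : nat) :
  \sum_(0 <= i < (sumn s).+1) acoef s i * y%:R ^+ i
    = (\prod_(a <- s) y ^_ a)%N%:R.
Proof.
pose p := \prod_(a <- s) rising_poly 0 a.
have pE i : p`_i = \sum_(j : {ffun 'I_(size s) -> 'I_i.+1}
    | (\sum_(l < size s) j l)%N == i)
      \prod_(l < size s) (stirling1 (nth 0%N s l) (j l))%:R.
  rewrite /p (big_nth 0%N) big_mkord coef_prod_ffun; apply: eq_bigr => j _.
  by apply: eq_bigr => l _; rewrite stirling1_coef.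
have sp : (size p <= (sumn s).+1)%N.
  rewrite /p; elim: (s) => [|a s' IHs]; first by rewrite big_nil size_poly1.
  rewrite big_cons /=; apply: leq_trans (size_polyMleq _ _) _.
  by rewrite -subn1 leq_subLR add1n -addnS -addSn leq_add ?size_rising_poly //.
rewrite (eq_bigr (fun i => (-1) ^+ (sumn s - i) * p`_i * y%:R ^+ i));
  last by move=> i _; rewrite pE.
rewrite sum_signed_coef // /p natr_prod; elim: (s) => [|a s' IHs].
  by rewrite !big_nil expr0 hornerC.
rewrite !big_cons -IHs hornerM exprD mulrACA; congr (_ * _).
by rewrite -(rising_poly_horner 0) addn0.
Qed.

Lemma sum_rstirling1 (r n x : nat) :
  \sum_(0 <= j < n.+1)
    (rstirling1 r (n + r) (j + r))%:R * (-1) ^+ (n - j) * (x + r)%:R ^+ j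
  = (x ^_ n)%:R :> int.
Proof.
rewrite -(rising_poly_horner r) -sum_signed_coef ?size_rising_poly //.
by apply: eq_bigr => j _; rewrite rstirling1_coef [_`_j * _]mulrC.
Qed.

(** * Colourings and set partitions *)

Lemma eq_pblock_preim_partition (T : finType) (rT : eqType) (f : T -> rT) x y :
  (pblock (preim_partition f setT) x == pblock (preim_partition f setT) y)
    = (f x == f y).
Proof.
have eqR : {in [set: T] & &, equivalence_rel [rel x y | f x == f y]}.
  by split=> //= /eqP ->.
have /and3P[/eqP cov triv _] := preim_partitionP f setT.
by rewrite eq_pblock ?cov ?inE // pblock_equivalence_partition ?inE.
Qed.

(** A colouring with colour classes exactly [P] amounts to an injective choice of a colour for each
    block. *)
Lemma card_preim_partition (T C : finType) (P : {set {set T}}) :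
  partition P setT ->
  #|[set f : {ffun T -> C} | preim_partition f setT == P]| = (#|C| ^_ #|P|)%N.
Proof.
move=> partP; have /and3P[/eqP covP trivP P0] := partP.
pose D := {B : {set T} | B \in P}.
have inP t : pblock P t \in P by rewrite pblock_mem // covP inE.
pose F (g : {ffun D -> C}) : {ffun T -> C} :=
  [ffun t => g (Sub (pblock P t) (inP t))].
have exD (B : D) : exists x, x \in val B.
  by apply/set0Pn; apply: contraNneq P0 => <-; apply: (valP B).
(* A representative of each block, available because blocks of a partition are nonempty. *)
pose c (B : D) := xchoose (exD B).
have pblock_c B : pblock P (c B) = val B.
  by apply: def_pblock => //; [apply: (valP B) | apply: xchooseP].
have FcE g B : F g (c B) = g B.
  by rewrite ffunE; congr (g _); apply: val_inj; rewrite SubK pblock_c.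
have F_inj : injective F.
  by move=> g g' eqF; apply/ffunP=> B; rewrite -!FcE eqF.
have -> : #|P| = #|{: D}| by rewrite card_sig.
rewrite -card_inj_ffuns -(card_imset _ F_inj).
apply: eq_card => f; rewrite inE; apply/idP/imsetP => [/eqP eqf|[g]].
  have fE x y : (f x == f y) = (pblock P x == pblock P y).
    by rewrite -eqf eq_pblock_preim_partition.
  exists [ffun B => f (c B)].
    rewrite inE; apply/injectiveP => B B'; rewrite !ffunE => /eqP.
    by rewrite fE !pblock_c => /eqP/val_inj.
  by apply/ffunP=> t; rewrite !ffunE; apply/eqP; rewrite fE pblock_c SubK.
rewrite inE => /injectiveP g_inj ->.
rewrite -[X in _ == X](preim_partition_pblock partP).
apply/eqP/eq_imset => x; apply/setP=> y; rewrite !inE /= !ffunE.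
by apply/eqP/eqP => [/g_inj/(congr1 val)|eqxy] //; congr (g _); apply: val_inj.
Qed.

Lemma card_partition_leq (T : finType) (P : {set {set T}}) (D : {set T}) :
  partition P D -> (#|P| <= #|D|)%N.
Proof.
move=> partP; rewrite (card_partition partP) -sum1_card; apply: leq_sum => B BP.
by rewrite lt0n cards_eq0; apply: contraTneq BP => ->; case/and3P: partP.
Qed.

Definition segment_injective (s : seq nat) (N : nat) (C : finType) :
    {set {ffun 'I_N -> C}} :=
  [set f : {ffun 'I_N -> C} |
    [forall i : 'I_(size s), dinjectiveb f (segment N s i)]].

(** Injectivity of a colouring on a segment depends only on its colour classes, so colourings can be
    grouped by their partition, and partitions by number of blocks. *)
Lemma sum_vstirling2 (s : seq nat) (N x : nat) :
  (\sum_(k < N.+1) vstirling2 s N k * x ^_ k)%N = #|segment_injective s N 'I_x|.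
Proof.
pose Q (P : {set {set 'I_N}}) := partition P setT &&
  [forall i : 'I_(size s), dinjectiveb (pblock P) (segment N s i)].
have dinjE (f : {ffun 'I_N -> 'I_x}) (A : {set 'I_N}) :
    dinjectiveb (pblock (preim_partition f setT)) A = dinjectiveb f A.
  by apply/dinjectiveP/dinjectiveP => f_inj y z yA zA /eqP;
    [rewrite -eq_pblock_preim_partition|rewrite eq_pblock_preim_partition];
    move/eqP; apply: f_inj.
rewrite -[RHS]sum1_card
  (partition_big (fun f : {ffun 'I_N -> 'I_x} => preim_partition f setT) Q);
  last first.
  move=> f; rewrite inE /Q preim_partitionP /= => /forallP H.
  by apply/forallP=> i; rewrite dinjE.
(* [inord] loses nothing here: a partition of [N] points has at most [N] blocks. *)
rewrite [RHS](partition_big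
  (fun P : {set {set 'I_N}} => inord #|P| : 'I_N.+1) predT) //=.
apply: eq_bigr => k _; rewrite /vstirling2 -sum1_card big_distrl /=.
apply: eq_big => [P|P].
  rewrite !inE /Q -andbA andbAC; case partP : (partition P _) => //=.
  rewrite andbC.
  have leP : (#|P| < N.+1)%N.
    by rewrite ltnS -[N in (_ <= N)%N]card_ord -cardsT card_partition_leq.
  by rewrite -val_eqE /= inordK // andbC.
rewrite !inE -andbA => /and3P[partP /eqP <- injP].
rewrite mul1n sum1dep_card -[in LHS](card_ord x).
rewrite -(card_preim_partition _ partP).
apply: eq_card => f; rewrite !inE andbC; case: eqP => //= eqf.
by apply/esym/forallP=> i; rewrite -dinjE eqf; apply: (forallP injP).
Qed.

Lemma card_ffun_split (a b : nat) (C : finType)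
    (P : {set {ffun 'I_a -> C}}) (Q : {set {ffun 'I_b -> C}}) :
  #|[set f : {ffun 'I_(a + b) -> C} | ([ffun i => f (lshift b i)] \in P)
      && ([ffun i => f (rshift a i)] \in Q)]| = (#|P| * #|Q|)%N.
Proof.
pose G (u : {ffun 'I_a -> C} * {ffun 'I_b -> C}) : {ffun 'I_(a + b) -> C} :=
  [ffun i => match split i with inl j => u.1 j | inr j => u.2 j end].
have Gl u j : G u (lshift b j) = u.1 j by rewrite ffunE (unsplitK (inl j)).
have Gr u j : G u (rshift a j) = u.2 j by rewrite ffunE (unsplitK (inr j)).
have GlE u : [ffun i => G u (lshift b i)] = u.1.
  by apply/ffunP=> j; rewrite ffunE Gl.
have GrE u : [ffun i => G u (rshift a i)] = u.2.
  by apply/ffunP=> j; rewrite ffunE Gr.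
have G_inj : injective G.
  move=> u u' eqG; rewrite [u]surjective_pairing -GlE -GrE eqG GlE GrE.
  by rewrite -surjective_pairing.
rewrite -cardsX -(card_imset _ G_inj); apply: eq_card => f.
rewrite inE; apply/andP/imsetP => [[Pf Qf]|[[u v]]].
  exists ([ffun i => f (lshift b i)], [ffun i => f (rshift a i)]).
    by rewrite !inE Pf.
  apply/ffunP=> i; rewrite ffunE; have := splitK i.
  by case: (split i) => j /= <-; rewrite ffunE.
by rewrite inE => /andP[Pu Qv] ->; rewrite GlE GrE.
Qed.

(** Induction splits off the first segment, coloured injectively and independently of the rest; the
    last [n] points lie in no segment and are free. *)
Lemma card_segment_injective (s : seq nat) (n N : nat) (C : finType) :
  N = (sumn s + n)%N ->
  #|segment_injective s N C| = (#|C| ^ n * \prod_(a <- s) #|C| ^_ a)%N.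
Proof.
elim: s N => [|a s IHs] N defN.
  rewrite big_nil muln1 -[n]card_ord -card_ffun defN -cardsT.
  by apply: eq_card => f; rewrite !inE; apply/forallP=> -[].
rewrite big_cons mulnCA -(IHs _ erefl) -[in (_ ^_ a)%N](card_ord a).
rewrite -card_inj_ffuns -card_ffun_split.
move: defN; rewrite /= -addnA => -> {N IHs}; apply: eq_card => f; rewrite !inE.
apply/forallP/andP => /= [f_inj|[/injectiveP f_inj0 /forallP f_injS] i].
  split.
    apply/injectiveP=> i j; rewrite !ffunE => eqf.
    apply: (@lshift_inj _ (sumn s + n)).
    by apply: (dinjectiveP _ _ (f_inj ord0)) => //;
      rewrite inE /= take0 addn0 ltn_ord.
  apply/forallP=> i; apply/dinjectiveP=> x y.
  rewrite !inE !ffunE => xi yi eqf; apply: (@rshift_inj a).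
  apply: (dinjectiveP _ _ (f_inj (lift ord0 i))) => //;
    by rewrite inE /= !leq_add2l ltn_add2l.
apply/dinjectiveP=> x y; rewrite !inE.
(* Of the eight cases only two are consistent: both points in the first segment with [i] zero, or
   both beyond it with [i] positive. *)
rewrite -(splitK x) -(splitK y); case: (split x) (split y) => [u|u] [v|v] /=;
  case: i => [[|i] /= lti]; rewrite ?take0 ?addn0 ?leq_add2l ?ltn_add2l.
- by move=> _ _ eqf; congr (lshift _ _); apply: f_inj0; rewrite !ffunE.
- by rewrite leqNgt ltn_addr.
- by move=> _; rewrite ltnNge leq_addr.
- by rewrite leqNgt ltn_addr.
- by rewrite ltnNge leq_addr.
- by move=> _; rewrite leqNgt ltn_addr.
- by rewrite ltnNge leq_addr.
move=> ui vi eqf; congr (rshift _ _).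
by apply: (dinjectiveP _ _ (f_injS (Ordinal (lti : i < size s)%N)));
  rewrite ?inE ?ffunE.
Qed.

(** * The umbral functional *)

(** Stopping at [x] is exact, as [x ^_ k] vanishes for [k > x]; no degree bound on [p] is
    involved. *)
Definition umbral (x : nat) (p : {poly int}) : int :=
  \sum_(k < x.+1) p`_k * (x ^_ k)%:R.

Lemma umbral_sum (x : nat) (I : Type) (r : seq I) (P : pred I)
    (F : I -> {poly int}) :
  umbral x (\sum_(i <- r | P i) F i) = \sum_(i <- r | P i) umbral x (F i).
Proof.
rewrite /umbral exchange_big; apply: eq_bigr => k _.
by rewrite coef_sum mulr_suml.
Qed.

Lemma umbralZ (x : nat) (c : int) (p : {poly int}) :
  umbral x (c *: p) = c * umbral x p.
Proof.
by rewrite /umbral mulr_sumr; apply: eq_bigr => k _; rewrite coefZ mulrA.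
Qed.

Lemma ffactD (x j k : nat) : (x ^_ (j + k) = x ^_ j * (x - j) ^_ k)%N.
Proof.
elim: k => [|k IHk]; first by rewrite addn0 ffactn0 muln1.
by rewrite addnS !ffactnSr IHk subnDA mulnA.
Qed.

(** This is [ffactD] applied termwise; for [j > x] the truncated [x - j] is harmless because
    [x ^_ j] is zero. *)
Lemma umbral_XnM (x j : nat) (p : {poly int}) :
  umbral x ('X^j * p) = (x ^_ j)%:R * umbral (x - j) p.
Proof.
rewrite /umbral; have [lejx|ltxj] := leqP j x; last first.
  rewrite ffact_small // mul0r big1 // => -[k /= ltkx] _.
  by rewrite coefXnM (leq_trans _ ltxj) ?mul0r.
rewrite -(big_mkord predT (fun k => ('X^j * p)`_k * (x ^_ k)%:R)).
rewrite (big_cat_nat (leq0n j)) /=; last exact: leqW.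
rewrite big1_seq ?add0r => [|k]; last first.
  by rewrite mem_index_iota /= => ltkj; rewrite coefXnM ltkj mul0r.
rewrite -{1}[j]add0n big_addn subSn // big_mkord mulr_sumr.
apply: eq_bigr => k _; rewrite coefXnM ltnNge leq_addl /= addnK.
by rewrite addnC ffactD natrM mulrCA.
Qed.

Lemma umbral_Xn (x k : nat) : umbral x 'X^k = (x ^_ k)%:R.
Proof.
rewrite -['X^k]mulr1 umbral_XnM /umbral big_ord_recl coef1 ffactn0 mulr1.
by rewrite big1 ?addr0 ?mulr1 // => i _; rewrite coef1 mul0r.
Qed.

(** The system is triangular: the value at [k] involves only coefficients up to [k], the last one
    with weight [k!]. *)
Lemma umbral_inj (p q : {poly int}) :
  (forall x, umbral x p = umbral x q) -> p = q.
Proof.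
move=> eqpq; apply/polyP; elim/ltn_ind => k IHk; have := eqpq k.
rewrite /umbral !big_ord_recr /= (eq_bigr (fun i : 'I_k => q`_i * (k ^_ i)%:R)).
  move/addrI/mulIf; apply; rewrite ffactnn Num.Theory.pnatr_eq0 -lt0n.
  exact: fact_gt0.
by move=> i _; rewrite IHk.
Qed.

(* With k < a colours no colouring is injective on the last segment. *)
Lemma vstirling2_eq0 (s : seq nat) (a n k : nat) : (k < a)%N ->
  vstirling2 (rcons s a) (n + sumn (rcons s a)) k = 0%N.
Proof.
move=> ltka; set N := (n + _)%N.
have := card_segment_injective 'I_k (addnC _ _ : N = (_ + n)%N).
rewrite -sum_vstirling2 card_ord big_rcons /= (ffact_small ltka).
rewrite ?mul0n ?muln0 => /eqP; rewrite sum_nat_eq0 => /forallP.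
have ltkN : (k < N.+1)%N.
  by rewrite ltnS (leq_trans (ltnW ltka)) // /N sumn_rcons addnA leq_addl.
move/(_ (Ordinal ltkN)); rewrite /= ffactnn muln_eq0 => /orP[/eqP //|].
by rewrite eqn0Ngt fact_gt0.
Qed.

(** In the count of colourings by [x + a] colours, terms with fewer than [a] blocks vanish and the
    others contain [(x + a) ^_ (k + a) = (x + a) ^_ a * x ^_ k]. The common factor [(x + a) ^_ a],
    due to the last segment, is cancelled. *)
Lemma umbral_vbell_rcons (s : seq nat) (a n x : nat) :
  umbral x (vbell n (rcons s a))
    = ((x + a) ^ n * \prod_(b <- s) (x + a) ^_ b)%N%:R.
Proof.
have vlE : vlast (rcons s a) = a by rewrite /vlast last_rcons.
have viE : vinit (rcons s a) = s.
  by rewrite /vinit size_rcons -cats1 take_size_cat.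
have ffact_neq0 : ((x + a) ^_ a)%:R != 0 :> int.
  by rewrite Num.Theory.pnatr_eq0 -lt0n ffact_gt0 leq_addl.
apply: (mulfI ffact_neq0); rewrite /vbell viE vlE.
set N := (n + sumn (rcons s a))%N.
have defN : N.+1 = ((n + sumn s).+1 + a)%N by rewrite /N sumn_rcons addSn addnA.
have := card_segment_injective 'I_(x + a) (addnC _ _ : N = (_ + n)%N).
rewrite -sum_vstirling2 card_ord big_rcons /= => eqN.
rewrite -natrM mulnCA [((x + a) ^_ a * _)%N]mulnC -eqN.
rewrite natr_sum umbral_sum mulr_sumr.
rewrite -(big_mkord predT (fun k => (vstirling2 _ N k * (x + a) ^_ k)%N%:R)).
rewrite [RHS](big_cat_nat (leq0n a)) /=; last by rewrite defN leq_addl.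
rewrite [X in _ = X + _]big1_seq ?add0r => [|k]; last first.
  by rewrite mem_index_iota /= => ltka; rewrite vstirling2_eq0.
rewrite -[X in _ = \big[_/_]_(X <= _ < _) _]add0n big_addn defN addnK.
apply: eq_bigr => k _.
rewrite [_%:R * 'X^k]mulr_natl -scaler_nat umbralZ umbral_Xn.
by rewrite [(k + a)%N]addnC ffactD addnK mulrCA -!natrM.
Qed.

Lemma rbellE (n r : nat) : rbell n r = vbell n [:: r].
Proof.
rewrite /rbell /vbell /vinit /vlast /= !addn0; apply: eq_bigr => k _.
congr (_%:R * _); apply: eq_card => P; rewrite !inE; congr (_ && _).
have segE : segment (n + r) [:: r] 0 =i [set x : 'I_(n + r) | (x < r)%N].
  by move=> x; rewrite !inE /= addn0.
apply/idP/forallP => [P_inj [[|//] lt0]|/(_ ord0)] /=.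
  by rewrite (eq_dinjectiveb (frefl _) segE).
by rewrite /= (eq_dinjectiveb (frefl _) segE).
Qed.

Lemma umbral_rbell (n r x : nat) : umbral x (rbell n r) = ((x + r) ^ n)%N%:R.
Proof.
by rewrite rbellE -[[:: r]]/(rcons [::] r) umbral_vbell_rcons big_nil muln1.
Qed.

(** The left side is [umbral x] applied termwise to [rbell n r]. *)
Lemma sum_rstirling2 (r n x : nat) :
  \sum_(0 <= j < n.+1) (rstirling2 r (n + r) (j + r))%:R * (x ^_ j)%:R
    = ((x + r) ^ n)%N%:R :> int.
Proof.
rewrite -umbral_rbell umbral_sum; apply: eq_bigr => j _.
by rewrite [in RHS]mulr_natl -scaler_nat umbralZ umbral_Xn.
Qed.

Lemma umbral_vbell (s : seq nat) (n x : nat) : (0 < size s)%N ->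
  umbral x (vbell n s)
    = ((x + vlast s) ^ n * \prod_(b <- vinit s) (x + vlast s) ^_ b)%N%:R.
Proof.
case/lastP: s => // s a _; rewrite umbral_vbell_rcons /vlast last_rcons.
by rewrite /vinit size_rcons -cats1 take_size_cat.
Qed.

(** * Raising the last entry of the vector *)

Lemma nth_add_scaled (p : nat) (r : p.-tuple nat) (j i : nat) : (i < p)%N ->
  nth 0%N (add_scaled r j (e_last p)) i = (nth 0 r i + (i.+1 == p) * j)%N.
Proof.
move=> lt_ip; rewrite /add_scaled /e_last -(tnth_nth 0%N _ (Ordinal lt_ip)).
by rewrite !tnth_mktuple (tnth_nth 0%N) mulnC.
Qed.

Lemma vlast_add_scaled (p : nat) (r : p.-tuple nat) (j : nat) : (0 < p)%N ->
  vlast (add_scaled r j (e_last p)) = (vlast r + j)%N.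
Proof.
move=> p_gt0; rewrite /vlast -!nth_last !size_tuple nth_add_scaled ?prednK //.
by rewrite eqxx mul1n.
Qed.

Lemma vinit_add_scaled (p : nat) (r : p.-tuple nat) (j : nat) :
  vinit (add_scaled r j (e_last p)) = vinit r.
Proof.
rewrite /vinit !size_tuple; apply: (@eq_from_nth _ 0%N).
  by rewrite !size_take !size_tuple.
move=> i; rewrite size_takel ?size_tuple ?leq_pred // => lt_ip1.
rewrite !nth_take // nth_add_scaled; last exact: leq_trans lt_ip1 (leq_pred _).
by rewrite ltn_eqF ?addn0 // -ltn_predRL.
Qed.

Theorem theorem6 (p : nat) (hp : (1 <= p)%N) (r : p.-tuple nat)
    (hr : sorted leq r) (n m : nat) :
  [/\ vbell (n + m) r =
        \sum_(0 <= j < n.+1)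
          (rstirling2 (vlast r) (n + vlast r) (j + vlast r))%:R * 'X^j
          * vbell m (add_scaled r j (e_last p)),
      vbell (n + m) r =
        \sum_(0 <= i < (sumn (vinit r)).+1) \sum_(0 <= j < n.+1)
          (rstirling2 (vlast r) (n + vlast r) (j + vlast r))%:R
          * (acoef (vinit r) i)%:~R * 'X^j * rbell (m + i) (vlast r + j)
    & 'X^n * vbell m (add_scaled r n (e_last p)) =
        \sum_(0 <= j < n.+1)
          (rstirling1 (vlast r) (n + vlast r) (j + vlast r))%:R
          * (-1) ^+ (n - j) * vbell (m + j) r].
Proof.
have sz_r : (0 < size r)%N by rewrite size_tuple.
(* The factor ['X^j] lowers [x] by [j] while the last entry rises by [j]: their sum is unchanged and
   only [x ^_ j] remains. *)
have umbral_shift j x : umbral x ('X^j * vbell m (add_scaled r j (e_last p)))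
    = (x ^_ j)%:R * umbral x (vbell m r).
  rewrite umbral_XnM; have [lejx|ltxj] := leqP j x; last first.
    by rewrite ffact_small // !mul0r.
  rewrite !umbral_vbell ?size_tuple // vlast_add_scaled // vinit_add_scaled.
  by rewrite [(_ + j)%N]addnC addnA subnK.
have umbral_rshift k j x : umbral x ('X^j * rbell k (vlast r + j))
    = (x ^_ j)%:R * ((x + vlast r) ^ k)%N%:R.
  rewrite umbral_XnM; have [lejx|ltxj] := leqP j x; last first.
    by rewrite ffact_small // !mul0r.
  by rewrite umbral_rbell [(_ + j)%N]addnC addnA subnK.
split; apply: umbral_inj => x.
- apply/esym; rewrite umbral_sum (eq_bigr (fun j =>
    (rstirling2 (vlast r) (n + vlast r) (j + vlast r))%:R * (x ^_ j)%:R
      * umbral x (vbell m r))).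
    rewrite -mulr_suml sum_rstirling2 !umbral_vbell // -natrM mulnA.
    by rewrite expnD.
  move=> j _; rewrite -mulrA mulr_natl -scaler_nat umbralZ umbral_shift.
  by rewrite mulrA.
- apply/esym; rewrite umbral_sum (eq_bigr (fun i =>
    acoef (vinit r) i * (x + vlast r)%:R ^+ i
      * ((x + vlast r) ^ (n + m))%N%:R)).
    by rewrite -mulr_suml sum_acoef umbral_vbell // natrM mulrC.
  (* For fixed [i] the sum over [j] gives the [n]-th power of [x + vlast r]; the power [i] is set
     apart to be summed against [acoef]. *)
  move=> i _; rewrite umbral_sum (eq_bigr (fun j =>
    (rstirling2 (vlast r) (n + vlast r) (j + vlast r))%:R * (x ^_ j)%:R
      * (acoef (vinit r) i * ((x + vlast r) ^ (m + i))%N%:R))).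
    rewrite -mulr_suml sum_rstirling2 mulrCA -mulrA; congr (_ * _).
    by rewrite -natrX -!natrM -!expnD addnA [(i + _)%N]addnC.
  move=> j _; rewrite -2!mulrA mulr_natl -scaler_nat umbralZ mulrzl.
  rewrite -scaler_int intz umbralZ umbral_rshift.
  by rewrite [acoef _ _ * _]mulrCA [LHS]mulrA.
(* Expanding [x ^_ n] in powers of [x + vlast r], the [j]-th power raises the exponent [m] in the
   value of [vbell m r] to [m + j]. *)
rewrite umbral_shift -(sum_rstirling1 (vlast r)) mulr_suml [RHS]umbral_sum.
apply: eq_bigr => j _; rewrite -[in RHS]mulrA [in RHS]mulr_natl.
rewrite -scaler_nat umbralZ -(rmorph_sign polyC) mul_polyC umbralZ !umbral_vbell //.
by rewrite !natrM !natrX [(m + j)%N]addnC exprD !mulrA.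
Qed.
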